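(* Let $W=\bigoplus_{k\ge-1}W^k$ be a $\mathbb Z$-graded Lie superalgebra, and let $K,H\in W^1$ be odd elements with $[H,H]=[K,K]=[K,H]=0$ and $$\ker\big(\operatorname{ad}K|_{W^0_{\bar0}}\big)\subset[K,W^{-1}_{\bar1}].$$ If $h$ is an even element of $\Pi W^{-1}$ such that $[K,h]=0$, then there exists an infinite sequence of even elements $h_0=h,h_1,h_2,\dots\in\Pi W^{-1}$ such that $[H,h_n]=[K,h_{n+1}]$ for every $n\in\mathbb Z_{\ge0}$.
   Context: The base field has characteristic $0$. $W$ is a $\mathbb Z$-graded Lie superalgebra with parity denoted $\bar p$; $W^k_{\bar0},W^k_{\bar1}$ are the even and odd parts of $W^k$ with respect to $\bar p$. $\Pi W^{-1}$ is $W^{-1}$ with the opposite parity $p=1-\bar p$, so an even element of $\Pi W^{-1}$ is an odd element of $W^{-1}$. All brackets are computed in $W$. *)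

(* Defs.v *)
From HB Require Import structures.
From mathcomp Require Import all_boot all_order all_algebra.
From mathcomp Require Import boolp classical_sets.

Set Implicit Arguments.
Unset Strict Implicit.
Unset Printing Implicit Defensive.

Import GRing.Theory.

Local Open Scope classical_set_scope.
Local Open Scope ring_scope.

Record internal_direct_sum (F : fieldType) (V : lmodType F) (I : eqType)
    (A : I -> set V) : Prop := InternalDirectSum {
  ids_subspace : forall i, submod_closed [in A i];
  ids_span : forall x : V, exists (s : seq I) (f : I -> V),
    (forall i, A i (f i)) /\ x = \sum_(i <- s) f i;
  ids_indep : forall (s : seq I) (f : I -> V), uniq s ->
    (forall i, A i (f i)) -> \sum_(i <- s) f i = 0 ->
    forall i, i \in s -> f i = 0
}.

(* Parities are booleans: [false] is even, [true] is odd, and addition in Z/2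
   is [addb]. The skew-symmetry and Jacobi axioms below suffice in
   characteristic 0; small characteristics need additional axioms. *)
HB.mixin Record Lmodule_isLieSuperalgebra (F : fieldType) V
    of GRing.Lmodule F V := {
  parity : bool -> set V;
  bracket : V -> V -> V;
  parity_direct : internal_direct_sum parity;
  bracket_linearl : forall y, linear (fun x => bracket x y);
  bracket_linearr : forall x, linear (bracket x);
  bracket_parity : forall (a b : bool) (x y : V),
    parity a x -> parity b y -> parity (a (+) b) (bracket x y);
  bracket_skew : forall (a b : bool) (x y : V),
    parity a x -> parity b y ->
    bracket x y = - ((-1) ^+ (a && b) *: bracket y x);
  bracket_jacobi : forall (a b c : bool) (x y z : V),
    parity a x -> parity b y -> parity c z ->
    bracket x (bracket y z) =
      bracket (bracket x y) z + (-1) ^+ (a && b) *: bracket y (bracket x z)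
}.

#[short(type="lieSuperalgType")]
HB.structure Definition LieSuperalgebra (F : fieldType) :=
  {V of GRing.Lmodule F V & Lmodule_isLieSuperalgebra F V}.

Record is_Zgrading (F : fieldType) (W : lieSuperalgType F)
    (gr : int -> set W) : Prop := IsZgrading {
  Zgrading_direct : internal_direct_sum gr;
  Zgrading_super : forall (k : int) (x : W), gr k x ->
    exists x0 x1 : W, [/\ (gr k `&` parity false) x0,
                         (gr k `&` parity true) x1 & x = x0 + x1];
  Zgrading_bracket : forall (i j : int) (x y : W),
    gr i x -> gr j y -> gr (i + j) (bracket x y)
}.

Definition spart (F : fieldType) (W : lieSuperalgType F) (a : bool)
  (A : set W) : set W := A `&` parity a.

(* The part of parity [a] of the superspace Pi A, that is, of A with the
   opposite parity. *)
Definition Pi_spart (F : fieldType) (W : lieSuperalgType F) (a : bool)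
  (A : set W) : set W := spart (~~ a) A.

(* Main.v *)
Require Import Defs.
From HB Require Import structures.
From mathcomp Require Import all_boot all_order all_algebra.
From mathcomp Require Import boolp classical_sets.

Set Implicit Arguments.
Unset Strict Implicit.
Unset Printing Implicit Defensive.

Import GRing.Theory.

Local Open Scope classical_set_scope.
Local Open Scope ring_scope.

(** Every step of the recursion can be carried out because the condition
    [[K, [H, x]] = 0] on odd elements [x] of degree -1 propagates. It holds for
    [h], since [ad K] and [ad H] anticommute and [[K, h] = 0]. If it holds for
    [x], then [[H, x]] lies in the kernel of [ad K] on the even part of degree
    0, so [[H, x] = [K, y]] for some odd [y] of degree -1; moreover
    [[K, [H, y]] = - [H, [K, y]] = - [H, [H, x]] = 0], because [ad H] squares
    to zero in characteristic 0. *)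

Lemma bracketr0 (F : fieldType) (W : lieSuperalgType F) (x : W) :
  bracket x 0 = 0.
Proof.
by have := bracket_linearr x (-1) 0 0; rewrite scaler0 addr0 scaleN1r addNr.
Qed.

Lemma bracket0r (F : fieldType) (W : lieSuperalgType F) (y : W) :
  bracket 0 y = 0.
Proof.
by have := bracket_linearl y (-1) 0 0; rewrite scaler0 addr0 scaleN1r addNr.
Qed.

Lemma ad_odd_anticomm (F : fieldType) (W : lieSuperalgType F) (A B x : W) :
  parity true A -> parity true B -> parity true x -> bracket A B = 0 ->
  bracket A (bracket B x) = - bracket B (bracket A x).
Proof.
move=> oA oB ox AB.
by rewrite (bracket_jacobi _ _ _ _ _ _ oA oB ox) AB bracket0r add0r expr1 scaleN1r.
Qed.

Lemma ad_odd_square0 (F : fieldType) (charF0 : [pchar F] =i pred0)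
    (W : lieSuperalgType F) (A x : W) :
  parity true A -> parity true x -> bracket A A = 0 ->
  bracket A (bracket A x) = 0.
Proof.
move=> oA ox AA; set z := bracket A _.
have zN : z = - z by exact: ad_odd_anticomm.
have: (2%:R : F) *: z = 0 by rewrite scaler_nat mulr2n {1}zN addNr.
have two_neq0 := (pcharf0P F).1 charF0 2%N.
by move/eqP; rewrite scaler_eq0 two_neq0 => /eqP.
Qed.

Theorem corollary8p5 (F : fieldType) (charF0 : [pchar F] =i pred0)
    (W : lieSuperalgType F) (gr : int -> set W) (gr_W : is_Zgrading gr)
    (gr_ge : forall k : int, k < -1 -> gr k = [set 0])
    (K H : W) (K_odd : spart true (gr 1) K) (H_odd : spart true (gr 1) H)
    (HH : bracket H H = 0) (KK : bracket K K = 0) (KH : bracket K H = 0)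
    (ker_K : [set x | spart false (gr 0) x /\ bracket K x = 0] `<=`
             bracket K @` spart true (gr (-1)))
    (h : W) (h_even : Pi_spart false (gr (-1)) h) (Kh : bracket K h = 0) :
  exists hs : nat -> W,
    [/\ hs 0%N = h,
        forall n : nat, Pi_spart false (gr (-1)) (hs n)
      & forall n : nat, bracket H (hs n) = bracket K (hs n.+1)].
Proof.
have [gK oK] := K_odd; have [gH oH] := H_odd.
pose odd1 := spart true (gr (-1)).
pose P := [set x : W | odd1 x /\ bracket K (bracket H x) = 0].
have Ph : P h.
  split; first exact: h_even.
  by rewrite (ad_odd_anticomm oK oH h_even.2 KH) Kh bracketr0 oppr0.
have step (x : W) : exists y, P x -> P y /\ bracket H x = bracket K y.
  have [[[gx ox] KHx]|nPx] := pselect (P x); last by exists 0.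
  have Hx0 : spart false (gr 0) (bracket H x).
    split; first exact: (Zgrading_bracket gr_W gH gx).
    exact: (bracket_parity _ _ _ _ oH ox).
  have [y y_odd Ky] := ker_K _ (conj Hx0 KHx).
  exists y => _; split=> //; split=> //.
  rewrite (ad_odd_anticomm oK oH y_odd.2 KH) Ky.
  by rewrite (ad_odd_square0 charF0 oH ox HH) oppr0.
have [next nextP] := choice step.
have P_iter n : P (iter n next h).
  by elim: n => [//|n IHn]; have [] := nextP _ IHn.
exists (fun n => iter n next h); split=> // n; first exact: (P_iter n).1.
by have [_] := nextP _ (P_iter n).
Qed.
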